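(* Let $a>1$ and $0<c_1\le c_2$. There exists a constant $C>0$ depending only on $a,c_1,c_2$ such that for every $d\ge1$, every symmetric positive definite $H\in\mathbb{R}^{d\times d}$ whose eigenvalues $\lambda_1\ge\dots\ge\lambda_d>0$ satisfy $c_1 i^{-a}\le\lambda_i\le c_2 i^{-a}$ for all $i\in\{1,\dots,d\}$, and every mini-batch size $B\ge1$, the optimal heavy-ball spectral radius satisfies $$s^*(H,B)\ \ge\ 1-C\,\min\left\{B\,d^{-a},\ d^{-a/2}\right\}.$$ In particular, the transition to the accelerated regime (the batch size at which the two terms of the minimum are of the same order) occurs at $B^{\mathrm{crit}}_{\mathrm{HB}}\asymp d^{a/2}$.
   Context: Let $H\in\mathbb{R}^{d\times d}$ be symmetric positive definite with eigenvalues $\lambda_1\ge\dots\ge\lambda_d>0$ and let $\Lambda=\mathrm{diag}(\lambda_1,\dots,\lambda_d)$. For a step size $\eta>0$, a momentum parameter $\beta\in[0,1)$ and a batch size $B\ge1$, define the $2d\times 2d$ matrix (in $d\times d$ blocks) $$A=\begin{bmatrix}(1+\beta)I-\eta(1-\beta)\Lambda & -\beta I\\ I & 0\end{bmatrix}.$$ The heavy-ball (HB) covariance operator $\mathcal{T}_{H,\eta,\beta,B}$ is the linear map on the space of real symmetric $2d\times 2d$ matrices given by $$\mathcal{T}_{H,\eta,\beta,B}(S)=A\,S\,A^\top+\eta^2(1-\beta)^2\begin{bmatrix}\tfrac1B\,\mathrm{Tr}(\Lambda S^{11})\,\Lambda & 0\\ 0&0\end{bmatrix},$$ where $S^{11}$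 is the upper-left $d\times d$ block of $S$. Let $s(H,\eta,\beta,B)=\rho(\mathcal{T}_{H,\eta,\beta,B})$ be its spectral radius (the maximal modulus of its complex eigenvalues), and $$s^*(H,B)=\inf_{\eta>0,\ \beta\in[0,1)}s(H,\eta,\beta,B).$$ *)

(* Defs.v *)
From HB Require Import structures.
From mathcomp Require Import all_boot all_order all_algebra.
From mathcomp Require Import all_classical all_reals all_analysis.
From mathcomp Require Import complex ring.

Set Implicit Arguments.
Unset Strict Implicit.
Unset Printing Implicit Defensive.

Import Order.TTheory GRing.Theory Num.Theory.
Import numFieldNormedType.Exports.

Local Open Scope classical_set_scope.
Local Open Scope ring_scope.

Section Spectrum.
Variable R : realType.

(* The complex eigenvalues of a real matrix, i.e. the roots in R[i] of its
   characteristic polynomial, listed with algebraic multiplicity. *)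
Definition complex_spectrum n (M : 'M[R]_n) : seq R[i] :=
  sval (closed_field_poly_normal (char_poly (map_mx (real_complex R) M))).

Lemma complex_spectrumE n (M : 'M[R]_n) :
  char_poly (map_mx (real_complex R) M) =
  \prod_(z <- complex_spectrum M) ('X - z%:P).
Proof.
rewrite /complex_spectrum; case: closed_field_poly_normal => s /= {1}->.
by rewrite (monicP (char_poly_monic _)) scale1r.
Qed.

Lemma mem_complex_spectrum n (M : 'M[R]_n) (z : R[i]) :
  (z \in complex_spectrum M) = eigenvalue (map_mx (real_complex R) M) z.
Proof. by rewrite eigenvalue_root_char complex_spectrumE root_prod_XsubC. Qed.

(* Taking real parts loses nothing on a symmetric matrix, whose complex
   eigenvalues are real: see char_poly_eigenvalues. *)
Definition eigenvalues n (M : 'M[R]_n) : seq R :=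
  sort >=%R [seq complex.Re z | z <- complex_spectrum M].

Lemma symmx_spectrum_real n (M : 'M[R]_n) (z : R[i]) :
  M^T = M -> z \in complex_spectrum M -> z = real_complex R (complex.Re z).
Proof.
move=> symM; rewrite mem_complex_spectrum => /eigenvalueP[v vM v0].
set MC := map_mx _ M in vM.
have MCh : MC \is hermsymmx.
  apply: realsym_hermsym.
    by apply/is_hermitianmxP; rewrite expr0 scale1r map_mx_id // map_trmx symM.
  apply/mxOverP => i j; rewrite mxE.
  by rewrite complex_real.
have MCr := hermitian_spectral_diag_real MCh.
have /orthomx_spectralP MCE := hermitian_normalmx MCh.
set P := spectralmx MC in MCE; set D := spectral_diag MC in MCr MCE.
have Pu : P \in unitmx := spectral_unit MC.
pose w := v *m invmx P.
have w0 : w != 0.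
  by apply: contra_neq v0 => w0; rewrite -[v](mulmxKV Pu) -/w w0 mul0mx.
have wD : w *m diag_mx D = z *: w.
  have := congr1 (mulmx^~ (invmx P)) vM.
  by rewrite {1}MCE !mulmxA mulmxK // -scalemxAl.
have /rV0Pn[j wj] := w0.
have /rowP/(_ j) := wD; rewrite mul_mx_diag mxE [RHS]mxE mulrC.
move/(mulIf wj) <-.
have /mxOverP/(_ 0 j) := MCr.
by move/RRe_real => {1}<-.
Qed.

Lemma char_poly_eigenvalues n (M : 'M[R]_n) :
  M^T = M -> char_poly M = \prod_(x <- eigenvalues M) ('X - x%:P).
Proof.
move=> symM; apply: (map_poly_inj (real_complex R)).
rewrite map_char_poly complex_spectrumE rmorph_prod /=.
rewrite (perm_big _ (permEl (perm_sort _ _))) /= big_map !big_seq.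
apply: eq_bigr => z zM.
by rewrite rmorphB /= map_polyX map_polyC /= -(symmx_spectrum_real symM zM).
Qed.

(* With 0-based indexing, eigenval M i is the (i+1)-st largest eigenvalue. *)
Definition eigenval n (M : 'M[R]_n) (i : nat) : R := (eigenvalues M)`_i.

Definition posdefmx n (M : 'M[R]_n) : Prop :=
  M^T = M /\ forall v : 'rV[R]_n, v != 0 -> 0 < (v *m M *m v^T) 0 0.

(* The neutral element 0 of the maximum is harmless: moduli are nonnegative. *)
Definition spectral_radius (V : vectType R) (f : 'End(V)) : R :=
  \big[Num.max/0]_(z <- complex_spectrum
                          (passmx.mxof (vbasis fullv) (vbasis fullv) f))
    ComplexField.Normc.normc z.

End Spectrum.

Section SymmetricMatrices.
Variables (R : realType) (n : nat).

Definition antisym_part (S : 'M[R]_n) : 'M[R]_n := S - S^T.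

Fact antisym_part_linear : linear antisym_part.
Proof.
move=> k S T; rewrite /antisym_part linearP /= scalerBr opprD.
by rewrite addrACA.
Qed.
HB.instance Definition _ := GRing.isSemilinear.Build R _ _ _ antisym_part
  (GRing.semilinear_linear antisym_part_linear).

Definition symmx_space : {vspace 'M[R]_n} := lker (linfun antisym_part).

Lemma memv_symmx (S : 'M[R]_n) : (S \in symmx_space) = (S^T == S).
Proof. by rewrite memv_ker lfunE /= subr_eq0 eq_sym. Qed.

Definition symmx : vectType R := subvs_of symmx_space.

End SymmetricMatrices.

Section HeavyBall.
Variables (R : realType) (d : nat) (H : 'M[R]_d).
Variables (eta beta : R) (B : nat).

Definition Lambda : 'M[R]_d := diag_mx (\row_(i < d) eigenval H i).

Definition hb_mx : 'M[R]_(d + d) :=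
  block_mx ((1 + beta)%:M - (eta * (1 - beta)) *: Lambda) (- beta%:M)
           1%:M                                           0.

Definition hb_map (S : 'M[R]_(d + d)) : 'M[R]_(d + d) :=
  hb_mx *m S *m hb_mx^T +
  (eta ^+ 2 * (1 - beta) ^+ 2) *:
    block_mx ((B%:R^-1 * \tr (Lambda *m ulsubmx S)) *: Lambda) 0 0 0.

Fact hb_map_linear : linear hb_map.
Proof.
move=> k S T; rewrite /hb_map mulmxDr mulmxDl -scalemxAr -scalemxAl.
rewrite /ulsubmx linearP /= linearP /= mulmxDr -scalemxAr linearP /=.
rewrite scalerDr scalerA addrACA; congr (_ + _).
rewrite !scale_block_mx !scaler0 add_block_mx !addr0; congr block_mx.
by rewrite !scalerA -scalerDl; congr (_ *: _); ring.
Qed.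
HB.instance Definition _ := GRing.isSemilinear.Build R _ _ _ hb_map
  (GRing.semilinear_linear hb_map_linear).

Lemma hb_map_sym (S : 'M[R]_(d + d)) :
  S \in symmx_space R (d + d) -> hb_map S \in symmx_space R (d + d).
Proof.
rewrite !memv_symmx => /eqP symS; apply/eqP.
rewrite /hb_map linearD linearZ /= !trmx_mul trmxK symS mulmxA.
by rewrite tr_block_mx !trmx0 linearZ /= tr_diag_mx.
Qed.

(* The projection vsproj only retypes hb_map S as an element of the space of
   symmetric matrices, which hb_map preserves: see vsval_hb_operator. *)
Definition hb_restr (S : symmx R (d + d)) : symmx R (d + d) :=
  vsproj (symmx_space R (d + d)) (hb_map (vsval S)).

Fact hb_restr_linear : linear hb_restr.
Proof. by move=> k S T; rewrite /hb_restr !linearP. Qed.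
HB.instance Definition _ := GRing.isSemilinear.Build R _ _ _ hb_restr
  (GRing.semilinear_linear hb_restr_linear).

Definition hb_operator : 'End(symmx R (d + d)) := linfun hb_restr.

Lemma vsval_hb_operator (S : symmx R (d + d)) :
  vsval (hb_operator S) = hb_map (vsval S).
Proof. by rewrite lfunE /= vsprojK // hb_map_sym // subvsP. Qed.

Definition hb_radius : R := spectral_radius hb_operator.

End HeavyBall.

Definition hb_opt_radius (R : realType) d (H : 'M[R]_d) (B : nat) : R :=
  inf [set s | exists eta beta : R,
         [/\ 0 < eta, 0 <= beta, beta < 1 & s = hb_radius H eta beta B]].

(* Main.v *)
(* The operator T preserves the positive semidefinite cone, so a nonzero S >= 0
   with T S >= r S satisfies tr (T^k S) >= r^k tr S and forces rho(T) >= r: by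
   Cayley-Hamilton, tr (T^k S) obeys a linear recurrence whose characteristic
   roots are eigenvalues of T, hence grows at most like (rho(T) + e)^k.

   Witnesses S supported on a single eigendirection of H then give three bounds.
   With q = eta (1 - beta) lambda_i:
   - an eigenvector of mode i of A gives rho(T) >= t^2 with
     1 - t <= min (sqrt q, 2 eta lambda_i);
   - if q >= 2 (1 + beta) on mode 1, then rho(T) >= 1 without any noise;
   - otherwise the stationary covariance of mode 1 gives rho(T) >= 1 as soon as
     eta lambda_1 >= 2 B.
   So rho(T) < 1 forces eta < 2 B / c1 and eta (1 - beta) < 4 / c1, and the first
   bound at i = d yields both terms of the minimum. *)

Require Import Defs.
From HB Require Import structures.
From mathcomp Require Import all_boot all_order all_algebra.
From mathcomp Require Import all_classical all_reals all_analysis.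
From mathcomp Require Import complex ring lra.

Set Implicit Arguments.
Unset Strict Implicit.
Unset Printing Implicit Defensive.

Import Order.TTheory GRing.Theory Num.Theory.
Import numFieldNormedType.Exports.

Local Open Scope classical_set_scope.
Local Open Scope ring_scope.

(** * Spectral radius and growth of iterates *)

(** Induction on the factors, generalised over [W]: [W M^(k+1)] is [z W M^k] plus the term for
    [W (M - z)], which the induction hypothesis bounds. The gap [r > rho] absorbs the polynomial
    factors that repeated roots create. *)
Lemma mx_power_bound (F : numFieldType) (n : nat) (M : 'M[F]_n.+1)
    (s : seq F) (rho r : F) :
  0 <= rho -> rho < r -> (forall z, z \in s -> `|z| <= rho) ->
  forall W : 'M[F]_n.+1, W * \prod_(z <- s) (M - z%:M) = 0 ->
  exists2 K, 0 <= K & forall k i j, `|(W * M ^+ k) i j| <= K * r ^+ k.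
Proof.
move=> rho0 rhor; have r0 : 0 < r by apply: le_lt_trans rhor.
elim: s => [|z s IHs] zs W.
  rewrite big_nil mulr1 => ->; exists 0 => // k i j.
  by rewrite mul0r mxE normr0 mul0r.
rewrite big_cons mulrA => /IHs[w ws|K' K'0 HK'].
  by apply: zs; rewrite inE ws orbT.
have zrho : `|z| <= rho by apply: zs; rewrite mem_head.
have rr0 : 0 < r - rho by rewrite subr_gt0.
pose K0 := \sum_i \sum_j `|W i j|.
have K00 : 0 <= K0 by rewrite sumr_ge0 // => i _; rewrite sumr_ge0.
have HK0 i j : `|W i j| <= K0.
  rewrite /K0 (bigD1 i) //= (bigD1 j) //= -addrA lerDl addr_ge0 //.
    exact: sumr_ge0.
  by apply: sumr_ge0 => ? _; apply: sumr_ge0.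
have K'r : 0 <= K' / (r - rho) by rewrite divr_ge0 // ltW.
(* A constant [K >= K0] with [rho K + K' <= K r], which carries the bound from [k] to [k + 1]. *)
exists (K0 + K' / (r - rho)) => [|k i j]; first by rewrite addr_ge0.
elim: k => [|k IHk]; first by rewrite mulr1 expr0 mulr1 (le_trans (HK0 i j)) // lerDl.
have -> : W * M ^+ k.+1 = z *: (W * M ^+ k) + W * (M - z%:M) * M ^+ k.
  rewrite mulrBr mulrBl -mulrA -exprS [_ * z%:M]mul_mx_scalar -scalerAl.
  by rewrite addrC subrK.
rewrite mxE [in X in `|X|]mxE.
apply: le_trans (ler_normD _ _) _; rewrite normrM.
apply: le_trans (lerD (ler_pM _ _ zrho IHk) (HK' k i j)) _ => //.
rewrite mulrA -mulrDl exprS mulrA ler_wpM2r ?exprn_ge0 ?(ltW r0) //.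
rewrite -subr_ge0.
have -> : (K0 + K' / (r - rho)) * r - (rho * (K0 + K' / (r - rho)) + K') =
   K0 * (r - rho) by field; rewrite gt_eqF.
by rewrite mulr_ge0 // ltW.
Qed.

(** Cayley-Hamilton allows [W = 1] with the whole complex spectrum as the list of factors. *)
Lemma real_mx_power_bound (R : realType) (n : nat) (M : 'M[R]_n) (rho r : R)
    (w : 'rV[R]_n) :
  0 <= rho -> rho < r ->
  (forall z, z \in complex_spectrum M -> ComplexField.Normc.normc z <= rho) ->
  exists2 K, 0 <= K & forall k j, `|(w *m M ^+ k) 0 j| <= K * r ^+ k.
Proof.
case: n M w => [|n] M w rho0 rhor Mrho.
  by exists 0 => // k [].
pose C := real_complex R.
have [||||] := @mx_power_bound _ n (map_mx C M) (complex_spectrum M)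
  (C rho) (C r) _ _ _ 1.
- by rewrite ler0c.
- by rewrite ltcR.
- by move=> z /Mrho; rewrite -lecR.
- have := Cayley_Hamilton (map_mx C M).
  rewrite complex_spectrumE rmorph_prod /= mul1r => CH; rewrite -[RHS]CH.
  by apply: eq_bigr => z _; rewrite rmorphB /= horner_mx_X horner_mx_C.
move=> K K0 HK.
have KE : K = C (complex.Re K) by rewrite /C RRe_real ?ger0_real.
rewrite KE ler0c in K0.
exists (\sum_i `|w 0 i| * complex.Re K) => [|k j].
  by apply: sumr_ge0 => i _; rewrite mulr_ge0.
rewrite mxE mulr_suml (le_trans (ler_norm_sum _ _ _)) //.
apply: ler_sum => i _; rewrite normrM -mulrA ler_wpM2l //.
have := HK k i j; rewrite mul1r KE -!rmorphXn /= mxE -rmorphM /=.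
by rewrite normc_def /= expr0n /= addr0 sqrtr_sqr lecR.
Qed.

Lemma spectral_radius_ge0 (R : realType) (V : vectType R) (f : 'End(V)) :
  0 <= spectral_radius f.
Proof. exact: bigmax_ge_id. Qed.

Lemma spectral_radius_growth (R : realType) (V : vectType R) (f : 'End(V))
    (phi : {scalar V}) (v : V) (c q : R) :
  0 < c -> (forall k, c * q ^+ k <= phi (iter k f v)) ->
  q <= spectral_radius f.
Proof.
move=> c0 growth; rewrite leNgt; apply/negP => rhoq.
have rho0 := spectral_radius_ge0 f.
pose r := (spectral_radius f + q) / 2.
have rhor : spectral_radius f < r by rewrite /r; lra.
have rq : r < q by rewrite /r; lra.
have r0 : 0 < r by apply: le_lt_trans rhor.
have q0 : 0 < q by apply: lt_trans rq.
pose e := vbasis {:V}.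
have eP : basis_of {:V} e := vbasisP _.
have [|K K0 HK] := @real_mx_power_bound R _ (passmx.mxof e e f) _ _
  (passmx.rVof e v) rho0 rhor.
  move=> z zM.
  exact: le_bigmax_seq.
have iterE k : passmx.rVof e (iter k f v) =
    passmx.rVof e v *m passmx.mxof e e f ^+ k.
  elim: k => [|k IHk]; first by rewrite expr0 mulmx1.
  by rewrite iterS (passmx.rVof_app _ eP) IHk -mulmxA exprSr.
pose K' := K * \sum_(j < \dim {:V}) `|phi e`_j|.
have K'0 : 0 <= K' by rewrite mulr_ge0 // sumr_ge0.
have upper k : phi (iter k f v) <= K' * r ^+ k.
  rewrite -(passmx.rVofK eP (iter k f v)) /passmx.vecof linear_sum /=.
  apply: le_trans (ler_norm _) _; apply: le_trans (ler_norm_sum _ _ _) _.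
  rewrite /K' mulrAC mulr_sumr; apply: ler_sum => j _.
  by rewrite linearZ /= normrM ler_wpM2r // iterE HK.
have rq0 : 0 <= r / q by rewrite divr_ge0 // ltW.
have rq1 : `|r / q| < 1.
  by rewrite ger0_norm // ltr_pdivrMr // mul1r.
(* The [+ 1] keeps the quotient positive when [K' = 0]; once [(r / q)^N] falls below it, the two
   growth bounds contradict each other. *)
have c1 : 0 < c / (K' + 1) by rewrite divr_gt0 // ltr_wpDl.
have [N _ /(_ N (leqnn N))] := cvgr0_norm_lt _ (cvg_expr rq1) _ c1.
rewrite /= ger0_norm ?exprn_ge0 //.
rewrite ltr_pdivlMr ?ltr_wpDl // expr_div_n mulrAC ltr_pdivrMr ?exprn_gt0 //.
apply/negP; rewrite -leNgt; apply: le_trans (growth N) _.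
apply: le_trans (upper N) _; rewrite mulrC ler_wpM2l ?exprn_ge0 ?(ltW r0) //.
by rewrite lerDl.
Qed.

(** * The positive semidefinite cone *)

Definition psdmx (R : realType) (n : nat) (S : 'M[R]_n) : Prop :=
  forall v : 'rV[R]_n, 0 <= (v *m S *m v^T) 0 0.

Lemma psdmxD (R : realType) n (S T : 'M[R]_n) :
  psdmx S -> psdmx T -> psdmx (S + T).
Proof.
by move=> S0 T0 v; rewrite mulmxDr mulmxDl mxE addr_ge0 ?S0 ?T0.
Qed.

Lemma psdmxZ (R : realType) n (c : R) (S : 'M[R]_n) :
  0 <= c -> psdmx S -> psdmx (c *: S).
Proof.
by move=> c0 S0 v; rewrite -scalemxAr -scalemxAl mxE mulr_ge0 ?S0.
Qed.

Lemma psdmx_conj (R : realType) m n (A : 'M[R]_(m, n)) (S : 'M[R]_n) :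
  psdmx S -> psdmx (A *m S *m A^T).
Proof.
by move=> S0 v; have := S0 (v *m A); rewrite trmx_mul !mulmxA.
Qed.

Lemma psdmx_diag_ge0 (R : realType) n (S : 'M[R]_n) i : psdmx S -> 0 <= S i i.
Proof.
by move=> /(_ (delta_mx 0 i)); rewrite -rowE trmx_delta -colE !mxE.
Qed.

Lemma psdmx_trace_ge0 (R : realType) n (S : 'M[R]_n) : psdmx S -> 0 <= \tr S.
Proof. by move=> S0; apply: sumr_ge0 => i _; apply: psdmx_diag_ge0. Qed.

Lemma psdmx_diag (R : realType) n (D : 'rV[R]_n) :
  (forall i, 0 <= D 0 i) -> psdmx (diag_mx D).
Proof.
move=> D0 v; rewrite mul_mx_diag mxE; apply: sumr_ge0 => i _.
by rewrite !mxE mulrAC mulr_ge0 // -expr2 sqr_ge0.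
Qed.

Lemma psdmx_ulblock (R : realType) m n (S : 'M[R]_m) :
  psdmx S -> psdmx (block_mx S 0 0 (0 : 'M[R]_n)).
Proof.
move=> S0 v; rewrite -[v]hsubmxK mul_row_block !mulmx0 !addr0 tr_row_mx.
by rewrite mul_row_col mul0mx addr0 S0.
Qed.

Lemma psdmx_ulsub (R : realType) m n (S : 'M[R]_(m + n)) :
  psdmx S -> psdmx (ulsubmx S).
Proof.
move=> S0 v; have := S0 (row_mx v 0).
rewrite -{1}[S]submxK mul_row_block !mul0mx !addr0 tr_row_mx mul_row_col.
by rewrite trmx0 mulmx0 addr0.
Qed.

(** The difference is the noise block, whose coefficient involves the trace of [Lambda S11]: a sum
    of eigenvalues times diagonal entries of [S11], all nonnegative. *)
Lemma hb_map_sub_psd (R : realType) (d : nat) (H : 'M[R]_d) (eta beta : R)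
    (B : nat) (S : 'M[R]_(d + d)) :
  (forall i : 'I_d, 0 <= eigenval H i) -> psdmx S ->
  psdmx (hb_map H eta beta B S - hb_mx H eta beta *m S *m (hb_mx H eta beta)^T).
Proof.
move=> H0 S0; rewrite /hb_map addrC addKr; apply: psdmxZ.
  by rewrite mulr_ge0 ?sqr_ge0.
apply/psdmx_ulblock/psdmxZ; last by apply: psdmx_diag => i; rewrite mxE.
rewrite mulr_ge0 ?invr_ge0 //; apply: sumr_ge0 => i _.
rewrite mul_diag_mx mxE mulr_ge0 //; first by rewrite mxE.
exact/psdmx_diag_ge0/psdmx_ulsub.
Qed.

Lemma hb_map_psd (R : realType) (d : nat) (H : 'M[R]_d) (eta beta : R)
    (B : nat) (S : 'M[R]_(d + d)) :
  (forall i : 'I_d, 0 <= eigenval H i) -> psdmx S ->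
  psdmx (hb_map H eta beta B S).
Proof.
move=> H0 S0; set A := hb_mx H eta beta.
rewrite -[hb_map _ _ _ _ _](subrK (A *m S *m A^T)).
by apply: psdmxD; [apply: hb_map_sub_psd | apply: psdmx_conj].
Qed.

Lemma hb_radius_ge (R : realType) (d : nat) (H : 'M[R]_d) (eta beta : R)
    (B : nat) (S : 'M[R]_(d + d)) (r : R) :
  (forall i : 'I_d, 0 <= eigenval H i) -> S^T = S -> psdmx S -> 0 < \tr S ->
  0 <= r -> psdmx (hb_map H eta beta B S - r *: S) ->
  r <= hb_radius H eta beta B.
Proof.
move=> H0 symS S0 trS r0 TS.
have SK : vsval (vsproj (symmx_space R (d + d)) S) = S.
  by rewrite vsprojK // memv_symmx symS.
pose phi : {scalar symmx R (d + d)} := (@mxtrace R (d + d) \o vsval).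
apply: (@spectral_radius_growth R _ _ phi (vsproj _ S) (\tr S)) => // k.
rewrite /phi /=.
have -> : vsval (iter k (hb_operator H eta beta B) (vsproj (symmx_space R (d + d)) S)) =
    iter k (hb_map H eta beta B) S.
  by elim: k => //= k IHk; rewrite vsval_hb_operator IHk.
(* The trace bound is strengthened to the semidefinite order, which [hb_map] preserves, so that
   induction on [k] applies. *)
suff /psdmx_trace_ge0 : psdmx (iter k (hb_map H eta beta B) S - r ^+ k *: S).
  by rewrite linearB linearZ /= subr_ge0 mulrC.
elim: k => [|k IHk]; first by move=> v; rewrite scale1r subrr mulmx0 mul0mx mxE.
rewrite iterS; set X := iter k _ S in IHk *.
have -> : hb_map H eta beta B X - r ^+ k.+1 *: S =
  hb_map H eta beta B (X - r ^+ k *: S) + r ^+ k *: (hb_map H eta beta B S - r *: S).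
  rewrite (linearB (hb_map H eta beta B)) (linearZZ (hb_map H eta beta B)).
  by rewrite scalerBr scalerA -exprSr addrA subrK.
by apply: psdmxD; [apply: hb_map_psd | apply: psdmxZ; rewrite ?exprn_ge0].
Qed.

(** * Covariances supported on a single eigendirection *)

(** The 2 by 2 covariance, with rows [(x, y)] and [(y, z)], of the current and previous iterates
    along eigendirection [i]. *)
Definition mode_mx (R : realType) (d : nat) (i : 'I_d) (x y z : R) : 'M[R]_(d + d) :=
  block_mx (x *: delta_mx i i) (y *: delta_mx i i)
           (y *: delta_mx i i) (z *: delta_mx i i).

Lemma mode_mx_sym (R : realType) (d : nat) (i : 'I_d) (x y z : R) :
  (mode_mx i x y z)^T = mode_mx i x y z.
Proof. by rewrite tr_block_mx !linearZ /= !trmx_delta. Qed.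

Lemma mode_mx_trace (R : realType) (d : nat) (i : 'I_d) (x y z : R) :
  \tr (mode_mx i x y z) = x + z.
Proof.
have trD : \tr (delta_mx i i : 'M[R]_d) = 1.
  rewrite /mxtrace (bigD1 i) //= big1 ?mxE ?eqxx ?addr0 // => j ji.
  by rewrite mxE (negPf ji).
by rewrite mxtrace_block !linearZ /= trD !mulr1.
Qed.

Lemma mode_mx_psd (R : realType) (d : nat) (i : 'I_d) (x y z : R) :
  (forall a b, 0 <= x * a ^+ 2 + 2 * y * a * b + z * b ^+ 2) ->
  psdmx (mode_mx i x y z).
Proof.
move=> Q v; rewrite -[v]hsubmxK mul_row_block tr_row_mx mul_row_col.
set a := lsubmx v; set b := rsubmx v.
have E (u w : 'rV[R]_d) : (u *m delta_mx i i *m w^T) 0 0 = u 0 i * w 0 i.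
  rewrite -(mul_delta_mx (0 : 'I_1)) mulmxA -colE -mulmxA -rowE.
  by rewrite mxE big_ord1 !mxE.
have addE (u w : 'M[R]_1) : (u + w) 0 0 = u 0 0 + w 0 0 by rewrite mxE.
have scaleE k (u : 'M[R]_1) : (k *: u) 0 0 = k * u 0 0 by rewrite mxE.
rewrite -!scalemxAr !mulmxDl -!scalemxAl !(addE, scaleE) !E.
have := Q (a 0 i) (b 0 i); congr (_ <= _); ring.
Qed.

(** On mode [i], [hb_mx] acts as the companion matrix with rows [(p, - beta)] and [(1, 0)]; the
    noise instead spreads over all modes in proportion to [Lambda]. *)
Lemma hb_map_mode (R : realType) (d : nat) (H : 'M[R]_d) (eta beta : R)
    (B : nat) (i : 'I_d) (x y z : R) (lam := eigenval H i)
    (p := 1 + beta - eta * (1 - beta) * lam) :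
  hb_map H eta beta B (mode_mx i x y z) =
  mode_mx i (p ^+ 2 * x - 2 * p * beta * y + beta ^+ 2 * z) (p * x - beta * y) x +
  block_mx ((eta ^+ 2 * (1 - beta) ^+ 2 * (B%:R^-1 * (lam * x))) *: Lambda H)
    0 0 0.
Proof.
pose D : 'M[R]_d := delta_mx i i.
have LD : Lambda H *m D = lam *: D.
  apply/matrixP => j k; rewrite mul_diag_mx !mxE.
  by case: (j =P i) => [->|]; rewrite ?mulr0.
have DL : D *m Lambda H = lam *: D.
  by rewrite -[LHS]trmxK trmx_mul tr_diag_mx trmx_delta LD linearZ /= trmx_delta.
have trD : \tr D = 1.
  have := mode_mx_trace i (1 : R) 0 0.
  by rewrite mxtrace_block !scale0r linear0 !addr0 scale1r.
rewrite /hb_map scale_block_mx !scaler0 scalerA.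
congr (_ + block_mx (_ *: _) _ _ _); last first.
  by rewrite block_mxKul -scalemxAr linearZ /= LD linearZ /= trD mulr1 [x * _]mulrC.
have -> : (hb_mx H eta beta)^T =
    block_mx ((1 + beta)%:M - (eta * (1 - beta)) *: Lambda H) 1%:M (- beta%:M) 0.
  rewrite tr_block_mx trmx1 trmx0 linearN linearB linearZ /=.
  by rewrite !tr_scalar_mx tr_diag_mx.
rewrite !mulmx_block !mul1mx !mul0mx !mulmx1 !mulmx0 !addr0.
rewrite /mode_mx -/D !(mulmxBl, mulmxBr, mulmxDl, mulmxDr, mulNmx, mulmxN).
rewrite !(mul_scalar_mx, mul_mx_scalar, =^~ scalemxAl, =^~ scalemxAr, LD, DL).
congr block_mx; apply/matrixP => j k; rewrite !mxE /p; ring.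
Qed.

Lemma hb_radius_mode (R : realType) (d : nat) (H : 'M[R]_d) (eta beta : R)
    (B : nat) (i : 'I_d) (x y z r : R) (lam := eigenval H i)
    (p := 1 + beta - eta * (1 - beta) * lam) :
  (forall i : 'I_d, 0 <= eigenval H i) ->
  (forall a b, 0 <= x * a ^+ 2 + 2 * y * a * b + z * b ^+ 2) ->
  0 <= x -> 0 < x + z -> 0 <= r ->
  (forall a b, 0 <=
    (p ^+ 2 * x - 2 * p * beta * y + beta ^+ 2 * z +
     eta ^+ 2 * (1 - beta) ^+ 2 * B%:R^-1 * lam ^+ 2 * x - r * x) * a ^+ 2 +
    2 * (p * x - beta * y - r * y) * a * b + (x - r * z) * b ^+ 2) ->
  r <= hb_radius H eta beta B.
Proof.
move=> H0 Q x0 xz r0 Q'; apply: (@hb_radius_ge _ _ _ _ _ _ (mode_mx i x y z)) => //.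
- exact: mode_mx_sym.
- exact: mode_mx_psd.
- by rewrite mode_mx_trace.
rewrite hb_map_mode -/lam -/p; set c := eta ^+ 2 * _ * _.
set x' := p ^+ 2 * x - _ + _; set y' := p * x - _.
have c0 : 0 <= c.
  apply: mulr_ge0; first by rewrite mulr_ge0 ?sqr_ge0.
  by rewrite mulr_ge0 ?invr_ge0 // mulr_ge0 // /lam H0.
have -> : mode_mx i x' y' x + block_mx (c *: Lambda H) 0 0 0 - r *: mode_mx i x y z =
  mode_mx i (x' + c * lam - r * x) (y' - r * y) (x - r * z) +
  block_mx (c *: (Lambda H - lam *: delta_mx i i)) 0 0 0.
  rewrite /mode_mx scale_block_mx opp_block_mx !add_block_mx.
  by congr block_mx; apply/matrixP => j k; rewrite !mxE; ring.
apply: psdmxD.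
  apply: mode_mx_psd => a b; have := Q' a b; congr (_ <= _).
  by rewrite /x' /y' /c; ring.
apply/psdmx_ulblock/psdmxZ => //.
have -> : Lambda H - lam *: delta_mx i i =
    diag_mx (\row_j (if j == i then 0 else eigenval H j)).
  apply/matrixP => j k; rewrite !mxE; case: (j =P i) => [->|ji] /=.
    by rewrite [k == i]eq_sym; case: (i =P k) => _; rewrite /lam; ring.
  by rewrite mulr0 subr0.
by apply: psdmx_diag => j; rewrite mxE; case: ifP.
Qed.

(** * Witnesses for a large spectral radius *)

(** The witness is [v v^T] for [v = (t, 1)], an eigenvector of the companion matrix with eigenvalue
    [t]: the deterministic part multiplies it by [t^2], and the noise [N] only adds to it. *)
Lemma hb_radius_root (R : realType) (d : nat) (H : 'M[R]_d) (eta beta : R)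
    (B : nat) (i : 'I_d) (t : R) :
  (forall i : 'I_d, 0 <= eigenval H i) ->
  t ^+ 2 = (1 + beta - eta * (1 - beta) * eigenval H i) * t - beta ->
  t ^+ 2 <= hb_radius H eta beta B.
Proof.
move=> H0 tE; apply: (@hb_radius_mode _ _ _ _ _ _ i (t ^+ 2) t 1) => //.
- by move=> a b; have := sqr_ge0 (t * a + b); congr (_ <= _); ring.
- exact: sqr_ge0.
- by rewrite ltr_wpDl ?sqr_ge0.
- exact: sqr_ge0.
move=> a b; set p := 1 + beta - _ in tE *.
set N := _ * B%:R^-1 * _ * _.
have N0 : 0 <= N by do ?[exact: sqr_ge0 | rewrite invr_ge0 | apply: mulr_ge0].
have -> : (p ^+ 2 * t ^+ 2 - 2 * p * beta * t + beta ^+ 2 * 1 + N - t ^+ 2 * t ^+ 2)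
   = N + ((p * t - beta) ^+ 2 - t ^+ 2 * t ^+ 2) by ring.
have -> : p * t ^+ 2 - beta * t - t ^+ 2 * t = t * (p * t - beta - t ^+ 2) by ring.
rewrite -tE -expr2 !subrr mulr1 subrr !(mulr0, mul0r, addr0).
by rewrite mulr_ge0 ?sqr_ge0.
Qed.

(* The witness is [Re v (Re v)^T + Im v (Im v)^T] for a complex eigenvector
   [v = (z, 1)] of the mode, where [|z|^2 = beta] and [2 Re z = p]. *)
Lemma hb_radius_complex (R : realType) (d : nat) (H : 'M[R]_d) (eta beta : R)
    (B : nat) (i : 'I_d) :
  (forall i : 'I_d, 0 <= eigenval H i) -> 0 <= beta ->
  (1 + beta - eta * (1 - beta) * eigenval H i) ^+ 2 <= 4 * beta ->
  beta <= hb_radius H eta beta B.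
Proof.
move=> H0 b0; set p := 1 + beta - _ => pb.
apply: (@hb_radius_mode _ _ _ _ _ _ i beta (p / 2) 1) => //.
- move=> a b; have -> : beta * a ^+ 2 + 2 * (p / 2) * a * b + 1 * b ^+ 2 =
    (p / 2 * a + b) ^+ 2 + (4 * beta - p ^+ 2) / 4 * a ^+ 2 by field.
  by rewrite addr_ge0 ?sqr_ge0 // mulr_ge0 ?sqr_ge0 // divr_ge0 // subr_ge0.
- by rewrite ltr_wpDl.
move=> a b; rewrite -/p.
set N := _ * B%:R^-1 * _ * _.
have N0 : 0 <= N by do ?[exact: sqr_ge0 | rewrite invr_ge0 | apply: mulr_ge0].
have -> : p ^+ 2 * beta - 2 * p * beta * (p / 2) + beta ^+ 2 * 1 + N -
  beta * beta = N by field.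
have -> : p * beta - beta * (p / 2) - beta * (p / 2) = 0 by field.
by rewrite mulr1 subrr !(mulr0, mul0r, addr0) mulr_ge0 ?sqr_ge0.
Qed.

(** Here [p <= - (1 + beta)], so the discriminant is at least [(1 - beta)^2] and the smaller real
    root is at most [-1]. *)
Lemma hb_radius_unstable (R : realType) (d : nat) (H : 'M[R]_d) (eta beta : R)
    (B : nat) (i : 'I_d) :
  (forall i : 'I_d, 0 <= eigenval H i) -> 0 <= beta -> beta < 1 ->
  2 * (1 + beta) <= eta * (1 - beta) * eigenval H i ->
  1 <= hb_radius H eta beta B.
Proof.
move=> H0 b0 b1 q2; pose p := 1 + beta - eta * (1 - beta) * eigenval H i.
have pb : p <= - (1 + beta) by rewrite /p; lra.
have disc0 : 0 <= p ^+ 2 - 4 * beta by nra.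
pose s := Num.sqrt (p ^+ 2 - 4 * beta).
have sE : s ^+ 2 = p ^+ 2 - 4 * beta by rewrite sqr_sqrtr.
have s0 : 0 <= s by apply: sqrtr_ge0.
have root : ((p - s) / 2) ^+ 2 = p * ((p - s) / 2) - beta.
  have -> : ((p - s) / 2) ^+ 2 = (p ^+ 2 - 2 * p * s + s ^+ 2) / 4 by field.
  by rewrite sE; field.
apply: le_trans (@hb_radius_root _ _ H eta beta B i _ H0 root).
have sb : 1 - beta <= s.
  rewrite -[leLHS]ger0_norm ?subr_ge0 ?(ltW b1) // -sqrtr_sqr.
  by rewrite ler_wsqrtr //; nra.
have : (p - s) / 2 <= -1 by lra.
by move=> ?; nra.
Qed.

(* The witness is the stationary covariance of the autoregression
   [x' = p x - beta y + noise] of the mode; it is positive semidefinite because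
   the mode itself is stable. *)
Lemma hb_radius_noise (R : realType) (d : nat) (H : 'M[R]_d) (eta beta : R)
    (B : nat) (i : 'I_d) :
  (forall i : 'I_d, 0 <= eigenval H i) -> 0 <= beta -> beta < 1 -> (0 < B)%N ->
  0 < eta -> 2 * B%:R <= eta * eigenval H i -> 1 <= hb_radius H eta beta B.
Proof.
move=> H0 b0 b1 B0 eta0 noise; set q := eta * (1 - beta) * eigenval H i.
have [unst|st] := leP (2 * (1 + beta)) q; first exact: hb_radius_unstable unst.
have B1 : 0 < B%:R :> R by rewrite ltr0n.
have q0 : 0 <= q by rewrite /q !mulr_ge0 ?subr_ge0 // ltW.
have qB : 2 * (1 - beta) <= q / B%:R.
  by rewrite ler_pdivlMr // /q mulrAC [leRHS]mulrAC; nra.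
set p := 1 + beta - q.
apply: (@hb_radius_mode _ _ _ _ _ _ i (1 + beta) p (1 + beta)) => //.
- move=> a b.
  have -> : (1 + beta) * a ^+ 2 + 2 * p * a * b + (1 + beta) * b ^+ 2 =
    ((1 + beta - p) * (a ^+ 2 + b ^+ 2) + p * (a + b) ^+ 2 ) by ring.
  (* Diagonalised along [a - b] and [a + b]: up to the factor 1/2 the coefficients are [q] and
     [2 (1 + beta) - q], nonnegative in the stable case. *)
  have -> : (1 + beta - p) * (a ^+ 2 + b ^+ 2) + p * (a + b) ^+ 2 =
    ((1 + beta - p) * (a - b) ^+ 2 + (1 + beta + p) * (a + b) ^+ 2) / 2 by field.
  by rewrite divr_ge0 // addr_ge0 // mulr_ge0 ?sqr_ge0 // /p; lra.
- by lra.
- by lra.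
move=> a b; rewrite -/q -/p.
have -> : p * (1 + beta) - beta * p - 1 * p = 0 by ring.
rewrite mul1r subrr !(mulr0, mul0r, addr0) mulr_ge0 ?sqr_ge0 //.
(* The other entries vanish by stationarity; in this one the noise gain [(1 + beta) q^2 / B]
   outweighs the loss [2 (1 - beta) (1 + beta) q], by [qB]. *)
rewrite [X in 0 <= X](_ : _ =
  q * ((1 + beta) * (q / B%:R - 2 * (1 - beta)) + (1 - beta) * q)); last first.
  by rewrite /p /q; set v := B%:R^-1; ring.
rewrite mulr_ge0 // addr_ge0 ?mulr_ge0 ?subr_ge0 ?(ltW b1) //; lra.
Qed.

(** [t] is the common modulus [sqrt beta] of the roots of [x^2 - p x + beta] when they are complex
    or double, and the larger root when they are real and distinct. Both bounds exploit the value
    [1 - p + beta = q] of this polynomial at 1. *)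
Lemma hb_mode_root (R : realType) (d : nat) (H : 'M[R]_d) (eta beta : R)
    (B : nat) (i : 'I_d) :
  (forall i : 'I_d, 0 <= eigenval H i) -> 0 <= beta -> beta < 1 -> 0 < eta ->
  exists t, [/\ t ^+ 2 <= hb_radius H eta beta B,
    1 - t <= Num.sqrt (eta * (1 - beta) * eigenval H i) &
    1 - t <= 2 * (eta * eigenval H i)].
Proof.
move=> H0 b0 b1 eta0; set l := eigenval H i; set q := eta * (1 - beta) * l.
have l0 : 0 <= l by apply: H0.
have el0 : 0 <= eta * l by rewrite mulr_ge0 // ltW.
have qE : q = (1 - beta) * (eta * l) by rewrite /q; ring.
have q0 : 0 <= q by rewrite qE mulr_ge0 // subr_ge0 ltW.
pose p := 1 + beta - q.
suff [t [t1 t2 t3]] : exists t, [/\ t ^+ 2 <= hb_radius H eta beta B,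
    t < 1 -> (1 - t) ^+ 2 <= q & t < 1 -> 1 - t <= 2 * (eta * l)].
  exists t; have [tge|tlt] := leP 1 t.
    have t1' : 1 - t <= 0 by rewrite subr_le0.
    by split=> //; apply: le_trans t1' _; rewrite ?sqrtr_ge0 // mulr_ge0.
  split=> //; last exact: t3.
  rewrite -[leLHS]ger0_norm ?subr_ge0 ?(ltW tlt) // -sqrtr_sqr.
  by rewrite ler_wsqrtr ?t2.
have [cplx|real] := leP (p ^+ 2) (4 * beta).
  pose t := Num.sqrt beta; exists t.
  have tE : t ^+ 2 = beta by rewrite sqr_sqrtr.
  have t0 : 0 <= t by apply: sqrtr_ge0.
  have tq : (1 - t) ^+ 2 <= q by rewrite /p in cplx; nra.
  split=> //; first by rewrite tE; apply: hb_radius_complex cplx.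
  (* Since [1 - beta = (1 - t) (1 + t)], a factor [1 - t] cancels, and [1 + t <= 2]. *)
  move=> t1; have : (1 - t) * (1 - t) <= (1 - t) * ((1 + t) * (eta * l)).
    rewrite -expr2 (le_trans tq) // qE -tE.
    by rewrite [leLHS](_ : _ = (1 - t) * ((1 + t) * (eta * l))) //; ring.
  by rewrite ler_pM2l ?subr_gt0 // => /le_trans; apply; nra.
have disc0 : 0 <= p ^+ 2 - 4 * beta by rewrite subr_ge0 ltW.
pose s := Num.sqrt (p ^+ 2 - 4 * beta).
have sE : s ^+ 2 = p ^+ 2 - 4 * beta by rewrite sqr_sqrtr.
have s0 : 0 <= s by apply: sqrtr_ge0.
pose t := (p + s) / 2; pose u := (p - s) / 2.
have tu : t * u = beta.
  have -> : t * u = (p ^+ 2 - s ^+ 2) / 4 by rewrite /t /u; field.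
  by rewrite sE; field.
have tpu : t + u = p by rewrite /t /u; field.
have ut : u <= t by rewrite /t /u; lra.
have root : t ^+ 2 = p * t - beta by rewrite -tpu -tu; ring.
have qtu : q = (1 - t) * (1 - u).
  have -> : (1 - t) * (1 - u) = 1 - (t + u) + t * u by ring.
  by rewrite tpu tu /p; ring.
exists t; split=> [|t1|t1].
- exact: (@hb_radius_root _ _ H eta beta B i _ H0 root).
- by rewrite qtu expr2 ler_wpM2l ?subr_ge0 ?(ltW t1) // lerD2l lerN2.
(* For [0 <= u], [u^2 <= t u = beta] gives [2 (1 - u) - (1 - beta) >= (1 - u)^2]. With [qtu], this
   bounds [(1 - beta) (1 - t)] by [2 q]. *)
have bu : 1 - beta <= 2 * (1 - u).
  have [u0|u0] := leP 0 u; last by lra.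
  by have := ler_wpM2r u0 ut; nra.
have b1' : 0 < 1 - beta by rewrite subr_gt0.
rewrite -(ler_pM2l b1').
have -> : (1 - beta) * (2 * (eta * l)) = 2 * q by rewrite qE; ring.
by rewrite qtu; nra.
Qed.

(** * Comparison of orders of growth *)

Lemma eqThetaP (R : realType) (f g : nat -> R) :
  f =Theta_\oo g <->
  exists k1 k2, [/\ 0 < k1, 0 < k2 &
    \forall n \near \oo, k1 * `|g n| <= `|f n| <= k2 * `|g n|].
Proof.
rewrite eqThetaE qualifE; split=> [/asboolP[[k1 k2] /= /andP[k10 k20] fg]|].
  by exists k1, k2; split=> //; near do apply/andP.
move=> [k1 [k2 [k10 k20 fg]]]; apply/asboolP; exists (k1, k2) => /=.
  by rewrite k10.
by near do apply/andP.
Unshelve. all: by end_near. Qed.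

(** Positivity of [h] is asked only eventually, because the factor [d^(-a)] used below is 0 at
    [d = 0]. *)
Lemma eqTheta_mulr (R : realType) (f g h fh gh : nat -> R) :
  (\forall n \near \oo, [/\ 0 < h n, fh n = f n * h n & gh n = g n * h n]) ->
  (fh =Theta_\oo gh <-> f =Theta_\oo g).
Proof.
move=> h0; rewrite !eqThetaP; split=> -[k1 [k2 [k10 k20 fg]]]; exists k1, k2;
  split=> //; near=> n.
  have [hn fE gE] : [/\ 0 < h n, fh n = f n * h n & gh n = g n * h n].
    by near: n.
  have : k1 * `|gh n| <= `|fh n| <= k2 * `|gh n| by near: n.
  by rewrite fE gE !normrM !mulrA !ler_pM2r ?normr_gt0 ?gt_eqF.
have [hn fE gE] : [/\ 0 < h n, fh n = f n * h n & gh n = g n * h n].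
  by near: n.
rewrite fE gE !normrM !mulrA !ler_pM2r ?normr_gt0 ?gt_eqF //.
by near: n.
Unshelve. all: by end_near. Qed.

(** * Assembling the two terms of the minimum *)

(** The 8 comes from the term in [B]: a factor 2 each from [1 - t^2 <= 2 (1 - t)],
    [1 - t <= 2 eta lambda_d] and [eta c1 < 2 B]. The square-root term costs only 4. *)
Lemma hb_radius_lower_bound (R : realType) (a c1 c2 : R) (d : nat)
    (H : 'M[R]_d) (B : nat) (eta beta : R) :
  0 < c1 -> c1 <= c2 -> (1 <= d)%N ->
  (forall i : 'I_d,
     c1 * i.+1%:R `^ (- a) <= eigenval H i <= c2 * i.+1%:R `^ (- a)) ->
  (1 <= B)%N -> 0 < eta -> 0 <= beta -> beta < 1 ->
  1 - 8 * (c2 / c1) * Num.min (B%:R * d%:R `^ (- a)) (d%:R `^ (- (a / 2)))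
    <= hb_radius H eta beta B.
Proof.
case: d H => // d H c10 c12 _ Hi B0 eta0 b0 b1.
have H0 (i : 'I_d.+1) : 0 <= eigenval H i.
  have /andP[/(le_trans _)-> //] := Hi i.
  by rewrite mulr_ge0 ?powR_ge0 // ltW.
set D : R := d.+1%:R `^ (- a); set E : R := d.+1%:R `^ _.
have DE : D = E ^+ 2.
  by rewrite /D /E expr2 -powRD ?pnatr_eq0 ?implybT //; congr (_ `^ _); field.
have E0 : 0 <= E by apply: powR_ge0.
have D0 : 0 <= D by apply: powR_ge0.
pose K := c2 / c1.
have K1 : 1 <= K by rewrite /K ler_pdivlMr // mul1r.
have K0 : 0 <= K by apply: le_trans K1.
rewrite -/K; set s := hb_radius _ _ _ _.
have [s1|s1] := leP 1 s.
  apply: le_trans s1; rewrite gerBl; apply: mulr_ge0; first by rewrite mulr_ge0.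
  by rewrite le_min E0 mulr_ge0.
(* Indices start at 0: [ord0] is the top mode, of weight 1, and [ord_max] the bottom mode, of weight
   [D]. *)
have l1 : c1 <= eigenval H (@ord0 d).
  by have /andP[] := Hi ord0; rewrite /= powR1 mulr1.
have ld : eigenval H (@ord_max d) <= c2 * D by have /andP[] := Hi ord_max.
have eB : eta * c1 < 2 * B%:R.
  rewrite ltNge; apply/negP => noise.
  have : 1 <= s.
    apply: (@hb_radius_noise _ _ H eta beta B ord0) => //.
    by apply: le_trans noise _; rewrite ler_pM2l.
  by rewrite leNgt s1.
have q4 : eta * (1 - beta) * c1 < 4.
  rewrite ltNge; apply/negP => unst.
  have : 1 <= s.
    apply: (@hb_radius_unstable _ _ H eta beta B ord0) => //.
    apply: (@le_trans _ _ 4); first by lra.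
    apply: le_trans unst _; rewrite ler_wpM2l // mulr_ge0 ?subr_ge0 ?ltW //.
  by rewrite leNgt s1.
have [t [ts tq tl]] := @hb_mode_root _ _ H eta beta B ord_max H0 b0 b1 eta0.
rewrite -/s in ts.
have {}ts : 1 - s <= 2 * (1 - t) by nra.
have c2E : c2 = K * c1 by rewrite /K divfK // gt_eqF.
rewrite c2E in ld.
have KD : 0 <= K * D by rewrite mulr_ge0.
have bound : 1 - s <= 8 * K * Num.min (B%:R * D) E; last by lra.
apply: le_trans ts _; rewrite /Num.min; case: ifP => _.
  suff : eta * eigenval H (@ord_max d) <= 2 * K * (B%:R * D) by move=> ?; lra.
  apply: (@le_trans _ _ (eta * (K * c1 * D))); first by rewrite ler_pM2l.
  have -> : eta * (K * c1 * D) = K * D * (eta * c1) by ring.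
  have -> : 2 * K * (B%:R * D) = K * D * (2 * B%:R) by ring.
  by rewrite ler_wpM2l // ltW.
have KE : 0 <= K * E by rewrite mulr_ge0.
suff : Num.sqrt (eta * (1 - beta) * eigenval H (@ord_max d)) <= 2 * (K * E).
  by move=> ?; lra.
have KE2 : 0 <= 2 * (K * E) by rewrite mulr_ge0.
rewrite -[leRHS]ger0_norm // -sqrtr_sqr ler_wsqrtr //.
apply: (@le_trans _ _ (eta * (1 - beta) * (K * c1 * D))).
  by rewrite ler_wpM2l // mulr_ge0 ?subr_ge0 ?ltW.
have -> : eta * (1 - beta) * (K * c1 * D) = eta * (1 - beta) * c1 * (K * D) by ring.
apply: (@le_trans _ _ (4 * (K * D))); first by rewrite ler_wpM2r // ltW.
(* As [1 <= K], [K D <= K^2 D], so the square root of [4 K D] is at most [2 K E]. *)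
have -> : (2 * (K * E)) ^+ 2 = 4 * (K * (K * D)) by rewrite DE; ring.
by rewrite ler_pM2l // ler_peMl.
Qed.

Theorem corollary1 (R : realType) (a c1 c2 : R)
    (ha : 1 < a) (hc1 : 0 < c1) (hc12 : c1 <= c2) :
  (exists C : R, 0 < C /\
    forall (d : nat) (H : 'M[R]_d) (B : nat),
      (1 <= d)%N ->
      posdefmx H ->
      (forall i : 'I_d,
         c1 * i.+1%:R `^ (- a) <= eigenval H i <= c2 * i.+1%:R `^ (- a)) ->
      (1 <= B)%N ->
      1 - C * Num.min (B%:R * d%:R `^ (- a)) (d%:R `^ (- (a / 2)))
        <= hb_opt_radius H B)
  /\
  (let comparable_terms (B : nat -> nat) :=
     (fun d => (B d)%:R * d%:R `^ (- a) : R)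
       =Theta_\oo (fun d => d%:R `^ (- (a / 2)) : R) in
   (exists B : nat -> nat,
      (forall d, (1 <= B d)%N) /\ comparable_terms B) /\
   (forall B : nat -> nat, (forall d, (1 <= B d)%N) ->
      (comparable_terms B <->
       (fun d => (B d)%:R : R) =Theta_\oo (fun d => d%:R `^ (a / 2) : R)))).
Proof.
split=> [|comparable_terms].
  exists (8 * (c2 / c1)); split=> [|d H B d1 _ Hi B1].
    by rewrite mulr_gt0 // divr_gt0 // (lt_le_trans hc1).
  apply: lb_le_inf.
    (* A lower bound passes to the infimum of an inhabited set; [eta = 1], [beta = 0] inhabits
       it. *)
    by exists (hb_radius H 1 0 B), 1, 0; split.
  by move=> _ [eta [beta [eta0 b0 b1 ->]]]; apply: hb_radius_lower_bound.
have equiv (B : nat -> nat) : comparable_terms B <->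
    (fun d => (B d)%:R : R) =Theta_\oo (fun d => d%:R `^ (a / 2) : R).
  (* Multiplication by [d^(-a)] turns [d^(a/2)] into [d^(-a/2)]. *)
  apply: (@eqTheta_mulr _ _ _ (fun d => d%:R `^ (- a))); near=> n.
  have n0 : 0 < n%:R :> R by rewrite ltr0n; near: n; exact: nbhs_infty_gt.
  split=> //; first exact: powR_gt0.
  by rewrite -powRD ?(gt_eqF n0) ?implybT //; congr (_ `^ _); field.
(* The successor ensures [B d >= 1] and [d^(a/2) < B d]; for [d >= 1] also
   [B d <= d^(a/2) + 1 <= 2 d^(a/2)], whence the constants 1 and 2. *)
split=> //; exists (fun d => (Num.truncn (d%:R `^ (a / 2) : R)).+1); split=> //.
apply/equiv/eqThetaP; exists 1, 2; split=> //; near=> n.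
have n1 : 1 <= n%:R :> R by rewrite ler1n; near: n; exact: nbhs_infty_gt.
set x := n%:R `^ _.
have x1 : 1 <= x.
  by rewrite -(powRr0 n%:R) ler_powR // divr_ge0 // (le_trans _ (ltW ha)).
have x0 : 0 <= x by apply: le_trans x1.
rewrite !ger0_norm // mul1r (ltW (truncnS_gt _)) /=.
rewrite -natr1; have := truncn_le x; rewrite x0; lra.
Unshelve. all: by end_near. Qed.
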